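(* Let $n\ge 0$ and let $\mathbf{C}_0,\dots,\mathbf{C}_n,\mathbf{C}_{n+1}=\mathbf{C}$ be categories with functors $\iota_k:\mathbf{C}_k\to\mathbf{C}_{k+1}$ and $j_k:\mathbf{C}_{k+1}\to\mathbf{C}_k$ for $k\in\{0,\dots,n\}$. Let $p:\mathbb{N}\to\mathbb{Z}$ be a function and, for $k\in\{0,\dots,n\}$ and $i\in\{k,k+1\}$, let $\tau^i_{p(k)}:\mathbf{C}_i\to\mathbf{C}_i$ be endofunctors. Assume there are natural isomorphisms of functors (i) $j_k\circ\iota_k\simeq 1_{\mathbf{C}_k}$ for all $k\in\{0,\dots,n\}$; (ii) $\tau^{k+1}_{p(k+1)}\circ\tau^{k+1}_{p(k)}\simeq\tau^{k+1}_{p(k)}$ for all $k\in\{0,\dots,n-1\}$; (iii) $\tau^k_{p(k)}\circ\tau^k_{p(k)}\simeq\tau^k_{p(k)}$ for all $k\in\{0,\dots,n\}$; (iv) $j_k\circ\tau^{k+1}_{p(k)}\simeq\tau^{k}_{p(k)}\circ j_k$ for all $k\in\{0,\dots,n\}$. Let $F_0\in\mathbf{C}_0$ satisfy $\tau^0_{p(0)}F_0\simeq F_0$. Then for every $A\in\mathbf{C}$: $A$ is of class $Del_{F_0}$ if and only if $$A\simeq \tau^{n+1}_{p(n)}\,\iota_n\,\tau^{n}_{p(n-1)}\,\iota_{n-1}\cdots\tau^{1}_{p(0)}\,\iota_0\,F_0 .$$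
   Context: Put $j^k=j_k\circ j_{k+1}\circ\dots\circ j_n:\mathbf{C}\to\mathbf{C}_k$ for $k\in\{0,\dots,n\}$ and $j^{n+1}=1_{\mathbf{C}}$. An object $A\in\mathbf{C}$ is of class $Del_{F_0}$ if (AX 1) $j^0A\simeq F_0$ in $\mathbf{C}_0$; (AX 2) $j^{k+1}A\simeq\tau^{k+1}_{p(k)}\,\iota_k\,j^kA$ in $\mathbf{C}_{k+1}$ for all $k\in\{0,\dots,n\}$. Here $\simeq$ between objects means that an isomorphism exists. *)

(* Defs.v *)
From mathcomp Require Import all_boot ssrint.

Set Implicit Arguments.
Unset Strict Implicit.
Unset Printing Implicit Defensive.

Record category := Category {
  obj :> Type;
  hom : obj -> obj -> Type;
  idm : forall x, hom x x;
  compm : forall x y z, hom y z -> hom x y -> hom x z;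
  compm1 : forall x y (f : hom x y), compm f (idm x) = f;
  comp1m : forall x y (f : hom x y), compm (idm y) f = f;
  compmA : forall x y z t (h : hom z t) (g : hom y z) (f : hom x y),
    compm h (compm g f) = compm (compm h g) f }.

Arguments hom {c} x y.
Arguments idm {c} x.
Arguments compm {c x y z} g f.

Definition is_iso (C : category) (x y : C) (f : hom x y) : Prop :=
  exists g : hom y x, compm g f = idm x /\ compm f g = idm y.

Definition isomorphic (C : category) (x y : C) : Prop :=
  exists f : hom x y, is_iso f.

Record functor (C D : category) := Functor {
  fobj :> C -> D;
  fmap : forall x y, hom x y -> hom (fobj x) (fobj y);
  fmap1 : forall x, fmap (idm x) = idm (fobj x);
  fmapM : forall x y z (g : hom y z) (f : hom x y),
    fmap (compm g f) = compm (fmap g) (fmap f) }.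

Arguments fmap {C D} F {x y} f : rename.

Definition functor_id (C : category) : functor C C :=
  @Functor C C (fun x => x) (fun x y f => f)
    (fun x => erefl) (fun x y z g f => erefl).

Section Composition.
Variables (C D E : category) (G : functor D E) (F : functor C D).

Let cmap x y (f : hom x y) : hom (G (F x)) (G (F y)) := fmap G (fmap F f).

Fact functor_comp_id x : cmap (idm x) = idm (G (F x)).
Proof. by rewrite /cmap !fmap1. Qed.

Fact functor_comp_compm x y z (g : hom y z) (f : hom x y) :
  cmap (compm g f) = compm (cmap g) (cmap f).
Proof. by rewrite /cmap !fmapM. Qed.

Definition functor_comp : functor C E :=
  Functor functor_comp_id functor_comp_compm.

End Composition.

Definition nat_isomorphic (C D : category) (F G : functor C D) : Prop :=
  exists eta : forall x : C, hom (F x) (G x),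
    (forall (x y : C) (f : hom x y),
       compm (eta y) (fmap F f) = compm (fmap G f) (eta x)) /\
    (forall x : C, is_iso (eta x)).

Declare Scope cat_scope.
Delimit Scope cat_scope with cat.
Notation "x ≃ y" := (isomorphic x y) (at level 70) : cat_scope.
Notation "F ≅ G" := (nat_isomorphic F G) (at level 70) : cat_scope.
Notation "G ∘ F" := (functor_comp G F)
  (at level 40, left associativity) : cat_scope.

(* [jpow j k] is the composite j_k ∘ j_(k+1) ∘ ... ∘ j_(N-1) : C_N -> C_k,
   the identity when k = N.  The recursion drops the bottom category: for k > 0
   the composite only involves the shifted family C_1, C_2, ..., C_N.  It type
   checks without casts because [lift ord0 i] has value [i.+1] definitionally. *)
Fixpoint jpow (N : nat) :
    forall (C : nat -> category) (j : forall i : 'I_N, functor (C i.+1) (C i))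
      (k : nat), k <= N -> functor (C N) (C k) :=
  match N with
  | 0 => fun C j k =>
    match k return k <= 0 -> functor (C 0) (C k) with
    | 0 => fun=> functor_id (C 0)
    | k'.+1 => fun lt_k0 => False_rect _ (notF lt_k0)
    end
  | N'.+1 => fun C j k =>
    let jS := @jpow N' (fun i => C i.+1) (fun i => j (lift ord0 i)) in
    match k return k <= N'.+1 -> functor (C N'.+1) (C k) with
    | 0 => fun=> functor_comp (j ord0) (jS 0 (leq0n N'))
    | k'.+1 => fun le_kN => jS k' le_kN
    end
  end.

Section Deligne.

(* Only C_0, ..., C_(n+1) matter, and only the tau^i_(p k) with k <= n and
   i = k or i = k.+1; the remaining values are unconstrained. *)
Variables (n : nat) (C : nat -> category).
Variables (iota : forall k : 'I_n.+1, functor (C k) (C k.+1)).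
Variables (j : forall k : 'I_n.+1, functor (C k.+1) (C k)).
Variables (p : nat -> int) (tau : forall i : nat, int -> functor (C i) (C i)).
Variable F0 : C 0.

Definition class_Del (A : C n.+1) : Prop :=
  isomorphic (jpow j (leq0n n.+1) A) F0 /\
  forall k : 'I_n.+1,
    isomorphic (jpow j (ltn_ord k) A)
               (tau k.+1 (p k) (iota k (jpow j (ltnW (ltn_ord k)) A))).

(* tau^k_(p (k-1)) iota_(k-1) ... tau^1_(p 0) iota_0 F0, an object of C_k *)
Fixpoint deligne_tower (k : nat) : k <= n.+1 -> C k :=
  match k return k <= n.+1 -> C k with
  | 0 => fun=> F0
  | k'.+1 => fun lt_kn =>
    tau k'.+1 (p k') (iota (Ordinal lt_kn) (deligne_tower (ltnW lt_kn)))
  end.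

Definition deligne_object : C n.+1 := deligne_tower (leqnn n.+1).

End Deligne.

(* Main.v *)
Require Import Defs.
From mathcomp Require Import all_boot ssrint.

(* Let T_0 = F0 and T_(k+1) = tau^(k+1)_(p k) iota_k T_k. The hypothesis on F0
   and (ii) give tau^k_(p k) T_k ≃ T_k for k <= n, so by (iv) and (i)
   j_k T_(k+1) ≃ tau^k_(p k) j_k iota_k T_k ≃ tau^k_(p k) T_k ≃ T_k.
   Hence A ≃ T_(n+1) propagates downwards to j^k A ≃ T_k for every k, which
   yields both axioms; conversely the axioms give j^k A ≃ T_k for every k by
   induction, and k = n+1 is the claim. *)

Set Implicit Arguments.
Unset Strict Implicit.
Unset Printing Implicit Defensive.

Local Open Scope cat_scope.

Lemma isomorphic_sym (C : category) (x y : C) : x ≃ y -> y ≃ x.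
Proof. by case=> f [g [gf fg]]; exists g, f. Qed.

Lemma isomorphic_trans (C : category) (x y z : C) : x ≃ y -> y ≃ z -> x ≃ z.
Proof.
case=> f [f' [f'f ff']] [g [g' [g'g gg']]].
exists (compm g f), (compm f' g'); split.
  by rewrite -compmA (compmA g') g'g comp1m.
by rewrite -compmA (compmA f) ff' comp1m.
Qed.

Lemma fobj_isomorphic (C D : category) (F : functor C D) (x y : C) :
  x ≃ y -> F x ≃ F y.
Proof.
case=> f [g [gf fg]]; exists (fmap F f), (fmap F g).
by rewrite -!fmapM gf fg !fmap1.
Qed.

Lemma nat_isomorphic_obj (C D : category) (F G : functor C D) (x : C) :
  F ≅ G -> F x ≃ G x.
Proof. by case=> eta [_ eta_iso]; exists (eta x). Qed.

(** Each unfolding of [jpow] shifts the family by one, so the identity at the top level surfaces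
    only after N of them. *)
Lemma jpow_id (N : nat) (C : nat -> category)
    (j : forall i : 'I_N, functor (C i.+1) (C i)) (le_NN : N <= N) (A : C N) :
  jpow j le_NN A = A.
Proof. by elim: N => [|N IHN] in C j le_NN A *; last exact: IHN. Qed.

(** The recursion exposes the outermost factor only at k = 0; for larger k the shifted family
    carries the induction on N. *)
Lemma jpow_step (N : nat) (C : nat -> category)
    (j : forall i : 'I_N, functor (C i.+1) (C i))
    (k : nat) (le_kN : k <= N) (lt_kN : k < N) (A : C N) :
  jpow j le_kN A = j (Ordinal lt_kN) (jpow j lt_kN A).
Proof.
elim: N => [|N IHN] // in C j k le_kN lt_kN A *.
case: k => [|k] in le_kN lt_kN *.
  rewrite /= (bool_irrelevance (leq0n N) lt_kN).
  by rewrite /ord0 (bool_irrelevance (ltn0Sn N) lt_kN).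
rewrite /= (IHN _ (fun i => j (lift ord0 i)) k le_kN lt_kN A).
(* The two indices of j have the same value and differ only in the bound proof,
   so the family is abstracted over that proof alone to stay well typed. *)
set x := jpow _ _ _.
pose j_at (lt : k.+1 < N.+1) : C k.+1 := j (Ordinal lt) x.
exact: (congr1 j_at (bool_irrelevance
  (@lift_subproof N.+1 0 (@Ordinal N k lt_kN)) lt_kN)).
Qed.

Section Tower.
Variables (n : nat) (C : nat -> category).
Variables (iota : forall k : 'I_n.+1, functor (C k) (C k.+1)).
Variables (j : forall k : 'I_n.+1, functor (C k.+1) (C k)).
Variables (p : nat -> int) (tau : forall i : nat, int -> functor (C i) (C i)).
Variable F0 : C 0.

Local Notation T := (deligne_tower iota p tau F0).

Lemma class_Del_tower (A : C n.+1) : class_Del iota j p tau F0 A ->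
  forall (k : nat) (le_kn : k <= n.+1), jpow j le_kn A ≃ T le_kn.
Proof.
case=> ax1 ax2; elim=> [|k IHk] lt_kn.
  by rewrite (bool_irrelevance lt_kn (leq0n n.+1)).
have := ax2 (Ordinal lt_kn).
rewrite /= (bool_irrelevance (ltn_ord (Ordinal lt_kn)) lt_kn).
move=> /isomorphic_trans; apply.
exact/fobj_isomorphic/fobj_isomorphic/IHk.
Qed.

(** Level 0 is (AX 1); in (AX 2) both sides are isomorphic to T_(k+1). *)
Lemma tower_class_Del (A : C n.+1) :
    (forall (k : nat) (le_kn : k <= n.+1), jpow j le_kn A ≃ T le_kn) ->
  class_Del iota j p tau F0 A.
Proof.
move=> jT; split=> [|[k lt_kn]]; first exact: jT.
rewrite /= (bool_irrelevance (ltn_ord (Ordinal lt_kn)) lt_kn).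
apply: isomorphic_trans (jT _ _) _.
exact/isomorphic_sym/fobj_isomorphic/fobj_isomorphic/jT.
Qed.

Hypothesis j_iota : forall k : 'I_n.+1, j k ∘ iota k ≅ functor_id (C k).
Hypothesis tau_tau_succ : forall k : 'I_n,
  tau k.+1 (p k.+1) ∘ tau k.+1 (p k) ≅ tau k.+1 (p k).
Hypothesis j_tau : forall k : 'I_n.+1,
  j k ∘ tau k.+1 (p k) ≅ tau k (p k) ∘ j k.
Hypothesis tau_F0 : tau 0 (p 0) F0 ≃ F0.

Lemma tau_tower (k : nat) (le_kn : k <= n.+1) :
  k <= n -> tau k (p k) (T le_kn) ≃ T le_kn.
Proof.
(* Level 0 is [tau_F0]. At level k+1 the outermost functor of the tower is tau^(k+1)_(p k), so (ii)
   applies; its range k < n is why level n+1 is excluded. *)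
case: k => [|k] // in le_kn * => lt_kn.
exact: (nat_isomorphic_obj _ (tau_tau_succ (Ordinal lt_kn))).
Qed.

Lemma j_tower (k : nat) (lt_kn : k < n.+1) :
  j (Ordinal lt_kn) (T lt_kn) ≃ T (ltnW lt_kn).
Proof.
apply: isomorphic_trans (nat_isomorphic_obj _ (j_tau (Ordinal lt_kn))) _.
apply: isomorphic_trans (tau_tower (ltnW lt_kn) lt_kn).
(* What remains is to cancel j_k iota_k under tau^k_(p k). *)
exact: fobj_isomorphic (nat_isomorphic_obj _ (j_iota (Ordinal lt_kn))).
Qed.

Lemma jpow_tower (A : C n.+1) : A ≃ deligne_object iota p tau F0 ->
  forall (k : nat) (le_kn : k <= n.+1), jpow j le_kn A ≃ T le_kn.
Proof.
(* Descending induction on k from the top level, where A is known, run on m = n+1-k. *)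
move=> A_T k; move Dm: (n.+1 - k) => m.
elim: m => [|m IHm] in k Dm * => le_kn.
  have Dk : k = n.+1 by apply/eqP; rewrite eqn_leq le_kn -subn_eq0 Dm.
  by rewrite {}Dk in le_kn *; rewrite jpow_id (bool_irrelevance le_kn (leqnn _)).
have lt_kn : k < n.+1 by rewrite -subn_gt0 Dm.
rewrite (jpow_step j le_kn lt_kn) (bool_irrelevance le_kn (ltnW lt_kn)).
apply: isomorphic_trans (j_tower lt_kn).
by apply/fobj_isomorphic/IHm; rewrite subnS Dm.
Qed.

End Tower.

Theorem proposition1p0p1 (n : nat) (C : nat -> category)
    (iota : forall k : 'I_n.+1, functor (C k) (C k.+1))
    (j : forall k : 'I_n.+1, functor (C k.+1) (C k))
    (p : nat -> int)
    (tau : forall i : nat, int -> functor (C i) (C i))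
    (j_iota : forall k : 'I_n.+1, j k ∘ iota k ≅ functor_id (C k))
    (tau_tau_succ : forall k : 'I_n,
       tau k.+1 (p k.+1) ∘ tau k.+1 (p k) ≅ tau k.+1 (p k))
    (tau_idem : forall k : 'I_n.+1, tau k (p k) ∘ tau k (p k) ≅ tau k (p k))
    (j_tau : forall k : 'I_n.+1, j k ∘ tau k.+1 (p k) ≅ tau k (p k) ∘ j k)
    (F0 : C 0%N) (tau_F0 : tau 0%N (p 0%N) F0 ≃ F0)
    (A : C n.+1) :
  class_Del iota j p tau F0 A <-> A ≃ deligne_object iota p tau F0.
Proof.
split=> [/class_Del_tower jT | A_T]; last exact/tower_class_Del/jpow_tower.
by have := jT _ (leqnn n.+1); rewrite jpow_id.
Qed.
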